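(* Let $n$ be a positive integer and let $a$ and $b$ be two distinct points of $H^n(\mathbb{R})$. \begin{enumerate} \item[(A)] The metric segment $I(a,b)=\{x\in H^n(\mathbb{R})\colon d_h(a,b)=d_h(a,x)+d_h(x,b)\}$ is a unique straight line segment in $H^n(\mathbb{R})$ that joins $a$ and $b$. \item[(B)] The set $L(a,b)$ of all $x\in H^n(\mathbb{R})$ such that $x,a,b$ are metrically collinear is a unique hyperbolic line passing through $a$ and $b$. \item[(C)] Every isometric map $\gamma\colon\mathbb{R}\to H^n(\mathbb{R})$ that sends $0$ to $a$ is of the form $\gamma(t)=T_a(\sinh(t)z)$, where $z\in H^n(\mathbb{R})$ is such that $\|z\|=1$. \end{enumerate}
   Context: The hyperbolic space is $H^n(\mathbb{R})=\mathbb{R}^n$ with the metric $d_h(x,y)=\cosh^{-1}([x][y]-\langle x,y\rangle)$, where $\langle\cdot,\cdot\rangle$ is the standard inner product, $[x]=\sqrt{1+\|x\|^2}$ with $\|\cdot\|$ the Euclidean norm, and $\cosh^{-1}(t)=\log(t+\sqrt{t^2-1})$ for $t\ge1$. For $y\in H^n(\mathbb{R})$, $T_y\colon H^n(\mathbb{R})\to H^n(\mathbb{R})$ is defined by $T_y(x)=x+\bigl([x]+\frac{\langle x,y\rangle}{[y]+1}\bigr)y$. A map is isometric if it preserves distances; $\mathbb{R}$ carries its usual metric. A straight line segment in a metric space is the image of a compact interval of $\mathbb{R}$ under an isometric map; it joins $a$ and $b$ if the endpoints of the interval are sent to $a$ and $b$. A straight line in a metric space is the image of $\mathbb{R}$ under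 an isometric map; straight lines in $(H^n(\mathbb{R}),d_h)$ are called hyperbolic lines. Points $a,b,c$ of a metric space $(X,d)$ are metrically collinear if there are $x,y,z$ with $\{x,y,z\}=\{a,b,c\}$ and $d(x,z)=d(x,y)+d(y,z)$. *)

(* Defs.v *)
From HB Require Import structures.
From mathcomp Require Import all_boot all_order all_algebra.
From mathcomp Require Import all_classical all_reals all_analysis.

Set Implicit Arguments.
Unset Strict Implicit.
Unset Printing Implicit Defensive.

Import Order.TTheory GRing.Theory Num.Theory.

Local Open Scope classical_set_scope.
Local Open Scope ring_scope.

Section MetricNotions.
Variables (R : realType) (X : Type) (d : X -> X -> R).

(* A map defined on D only is represented by a total map whose values outside
   of D are irrelevant. *)
Definition isometric_on (D : set R) (g : R -> X) : Prop :=
  forall s t, D s -> D t -> d (g s) (g t) = `|s - t|.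

Definition isometric (g : R -> X) : Prop := isometric_on setT g.

Definition segment_joining (S : set X) (a b : X) : Prop :=
  exists (p q : R) (g : R -> X),
    [/\ p <= q, isometric_on `[p, q] g, S = g @` `[p, q] &
        [set g p; g q] = [set a; b]].

Definition straight_line (L : set X) : Prop :=
  exists g : R -> X, isometric g /\ L = range g.

(* {x, y, z} = {a, b, c} is an equality of sets, so repetitions are allowed. *)
Definition metrically_collinear (a b c : X) : Prop :=
  exists x y z : X,
    [set x; y; z] = [set a; b; c] /\ d x z = d x y + d y z.

Definition metric_segment (a b : X) : set X :=
  [set x | d a b = d a x + d x b].

Definition metric_line (a b : X) : set X :=
  [set x | metrically_collinear x a b].

End MetricNotions.

Section HyperbolicSpace.
Variable R : realType.

Definition sinh (t : R) : R := (expR t - expR (- t)) / 2.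

Definition acosh (t : R) : R := ln (t + Num.sqrt (t ^+ 2 - 1)).

Variable n : nat.
Implicit Types x y : 'rV[R]_n.

Definition dotp x y : R := \sum_(i < n) x 0 i * y 0 i.

(* The library's norm on 'rV[R]_n is the sup norm. *)
Definition enorm x : R := Num.sqrt (dotp x x).

Definition bracket x : R := Num.sqrt (1 + enorm x ^+ 2).

Definition hdist x y : R := acosh (bracket x * bracket y - dotp x y).

Definition htrans y x : 'rV[R]_n :=
  x + (bracket x + dotp x y / (bracket y + 1)) *: y.

Definition hyperbolic_line (L : set 'rV[R]_n) : Prop := straight_line hdist L.

End HyperbolicSpace.

(* Main.v *)
(* Lift points to the hyperboloid, X = ([x], x), so that cosh d(x, y) is the
   Lorentz product of X and Y.  If d(x, z) = d(x, y) + d(y, z), with s = d(x, y)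
   and t = d(y, z), then sinh(s+t) Y - sinh t X - sinh s Z is a null vector
   orthogonal to the timelike vector Y, hence zero.  Thus a point metrically
   between two others is determined by its distances to them, and every
   isometric g satisfies sinh(t-r) g(s) = sinh(t-s) g(r) + sinh(s-r) g(t) for
   all real r, s, t; this gives uniqueness and the form of the geodesics.
   Existence holds because T_a preserves the Lorentz product. *)
Require Import Defs.
From mathcomp Require Import all_boot all_order all_algebra.
From mathcomp Require Import all_classical all_reals all_analysis.
From mathcomp Require Import ring lra.
Import Order.TTheory GRing.Theory Num.Theory.
Local Open Scope classical_set_scope.
Local Open Scope ring_scope.

(** * Identities for [sinh], [cosh] and [acosh] *)

Section HyperbolicFunctions.
Context {R : realType}.
Implicit Types s t : R.

Definition cosh t : R := (expR t + expR (- t)) / 2.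

Lemma cosh2 t : cosh t ^+ 2 = 1 + sinh t ^+ 2.
Proof.
have E : expR t * expR (- t) = 1 by rewrite -expRD subrr expR0.
by rewrite /cosh /sinh; field: E.
Qed.

Lemma cosh_gt0 t : 0 < cosh t.
Proof. by rewrite divr_gt0// addr_gt0// expR_gt0. Qed.

Lemma sinhN t : sinh (- t) = - sinh t.
Proof. by rewrite /sinh opprK; ring. Qed.

Lemma coshN t : cosh (- t) = cosh t.
Proof. by rewrite /cosh opprK addrC. Qed.

Lemma sinh0 : sinh (0 : R) = 0.
Proof. by rewrite /sinh oppr0 subrr mul0r. Qed.

Lemma sinhD s t : sinh (s + t) = sinh s * cosh t + cosh s * sinh t.
Proof. by rewrite /sinh /cosh opprD !expRD; field. Qed.

Lemma coshD s t : cosh (s + t) = cosh s * cosh t + sinh s * sinh t.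
Proof. by rewrite /sinh /cosh opprD !expRD; field. Qed.

Lemma sinhB s t : sinh (s - t) = sinh s * cosh t - cosh s * sinh t.
Proof. by rewrite sinhD sinhN coshN mulrN. Qed.

Lemma coshB s t : cosh (s - t) = cosh s * cosh t - sinh s * sinh t.
Proof. by rewrite coshD sinhN coshN mulrN. Qed.

Lemma sinh_gt0 t : 0 < t -> 0 < sinh t.
Proof. by move=> t0; rewrite divr_gt0// subr_gt0 ltr_expR; lra. Qed.

Lemma sinh_neq0 t : t != 0 -> sinh t != 0.
Proof.
case: (ltrgtP t 0) => // t0 _; last by rewrite gt_eqF ?sinh_gt0.
by rewrite -oppr_eq0 -sinhN gt_eqF// sinh_gt0// oppr_gt0.
Qed.

Lemma acosh_ge0 t : 1 <= t -> 0 <= acosh t.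
Proof. by move=> t1; rewrite ln_ge0// ler_wpDr ?sqrtr_ge0. Qed.

Lemma acoshK t : 1 <= t -> cosh (acosh t) = t.
Proof.
move=> t1; set r := Num.sqrt (t ^+ 2 - 1).
have r2 : r ^+ 2 = t ^+ 2 - 1 by rewrite sqr_sqrtr// subr_ge0 expr_ge1//; lra.
have p0 : 0 < t + r by rewrite ltr_wpDr ?sqrtr_ge0//; lra.
rewrite /cosh /acosh -/r expRN lnK ?posrE//.
have p1 : t + r != 0 by rewrite gt_eqF.
by field: r2.
Qed.

Lemma coshK t : acosh (cosh t) = `|t|.
Proof.
wlog t0 : t / 0 <= t => [W|].
  have [/W//|t0] := leP 0 t.
  by rewrite -coshN W ?normrN//; lra.
have s0 : 0 <= sinh t by rewrite divr_ge0// subr_ge0 ler_expR; lra.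
rewrite /acosh cosh2 addrAC subrr add0r sqrtr_sqr ger0_norm// ger0_norm//.
have -> : cosh t + sinh t = expR t by rewrite /cosh /sinh; field.
by rewrite expRK.
Qed.

End HyperbolicFunctions.

(** * The Euclidean inner product and the bracket *)

Section DotProduct.
Context {R : realType} {n : nat}.
Implicit Types (x y z : 'rV[R]_n) (k : R).

Lemma dotpC x y : dotp x y = dotp y x.
Proof. by apply: eq_bigr => i _; rewrite mulrC. Qed.

Lemma dotpDl x y z : dotp (x + y) z = dotp x z + dotp y z.
Proof. by rewrite -big_split; apply: eq_bigr => i _; rewrite mxE mulrDl. Qed.

Lemma dotpZl k x y : dotp (k *: x) y = k * dotp x y.
Proof. by rewrite mulr_sumr; apply: eq_bigr => i _; rewrite mxE mulrA. Qed.

Lemma dotpDr x y z : dotp z (x + y) = dotp z x + dotp z y.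
Proof. by rewrite !(dotpC z) dotpDl. Qed.

Lemma dotpZr k x y : dotp x (k *: y) = k * dotp x y.
Proof. by rewrite !(dotpC x) dotpZl. Qed.

Definition dotpE := (dotpDl, dotpDr, dotpZl, dotpZr).

Lemma dotp_ge0 x : 0 <= dotp x x.
Proof. by apply: sumr_ge0 => i _; rewrite -expr2 sqr_ge0. Qed.

Lemma dotp_eq0 x : dotp x x = 0 -> x = 0.
Proof.
move/psumr_eq0P => x0; apply/rowP => i; apply/eqP.
rewrite mxE -sqrf_eq0 expr2 x0// => j _; exact: sqr_ge0.
Qed.

Lemma dotp_CS x y : dotp x y ^+ 2 <= dotp x x * dotp y y.
Proof.
have := dotp_ge0 y; rewrite le_eqVlt => /orP[/eqP y0|y0].
  have -> : y = 0 *: (0 : 'rV[R]_n) by rewrite scale0r; exact/dotp_eq0/esym.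
  by rewrite !dotpZr !mul0r mulr0 expr0n.
(* The squared norm of this vector is |y|^2 times the Cauchy-Schwarz deficit. *)
have := dotp_ge0 (dotp y y *: x + (- dotp x y) *: y).
rewrite !dotpE (dotpC y x) => h.
rewrite -subr_ge0 -(pmulr_rge0 _ y0).
by apply: le_trans h _; rewrite le_eqVlt; apply/orP; left; apply/eqP; ring.
Qed.

Lemma enorm2 x : enorm x ^+ 2 = dotp x x.
Proof. by rewrite sqr_sqrtr// dotp_ge0. Qed.

Lemma bracket2 x : bracket x ^+ 2 = 1 + dotp x x.
Proof. by rewrite sqr_sqrtr enorm2// addr_ge0// dotp_ge0. Qed.

Lemma dotpE_bracket x : dotp x x = bracket x ^+ 2 - 1.
Proof. by rewrite bracket2; ring. Qed.

Lemma bracket_gt0 x : 0 < bracket x.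
Proof. by rewrite sqrtr_gt0 enorm2 ltr_wpDr// dotp_ge0. Qed.

Lemma bracket_eq x k : 0 <= k -> k ^+ 2 = 1 + dotp x x -> bracket x = k.
Proof. by move=> k0 e; rewrite /bracket enorm2 -e sqrtr_sqr ger0_norm. Qed.

End DotProduct.

(** * The Lorentz product on the hyperboloid and the maps T_a *)

Section HyperbolicSpace.
Context {R : realType} {n : nat}.
Implicit Types (x y z a b : 'rV[R]_n) (k t : R).

Definition lorentz x y : R := bracket x * bracket y - dotp x y.

(** Cauchy-Schwarz is strict here because [x]^2 = 1 + |x|^2. This makes the time coordinate in
    [bracket_htrans] positive. *)
Lemma dotp_lt_bracket x y : `|dotp x y| < bracket x * bracket y.
Proof.
have p0 : 0 < bracket x * bracket y by rewrite mulr_gt0 ?bracket_gt0.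
rewrite -(ger0_norm (ltW p0)) -ltr_sqr ?nnegrE// !real_normK ?num_real//.
rewrite exprMn !bracket2.
have := dotp_CS x y; have := dotp_ge0 x; have := dotp_ge0 y; nra.
Qed.

(** When 1 + <x,y> is positive, [x]^2 [y]^2 - (1 + <x,y>)^2 is |x - y|^2 plus the Cauchy-Schwarz
    deficit. *)
Lemma lorentz_ge1 x y : 1 <= lorentz x y.
Proof.
rewrite lerBrDr; have [h|h] := leP (1 + dotp x y) 0.
  by rewrite (le_trans h)// mulr_ge0// ltW ?bracket_gt0.
rewrite -ler_sqr ?nnegrE ?mulr_ge0 ?(ltW (bracket_gt0 _)) ?(ltW h)//.
rewrite exprMn !bracket2.
have := dotp_CS x y; have := dotp_ge0 (x + (-1) *: y).
by rewrite !dotpE (dotpC y x); nra.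
Qed.

Lemma cosh_hdist x y : cosh (hdist x y) = lorentz x y.
Proof. by rewrite acoshK// lorentz_ge1. Qed.

Lemma hdist_ge0 x y : 0 <= hdist x y.
Proof. by rewrite acosh_ge0// lorentz_ge1. Qed.

Lemma hdistC x y : hdist x y = hdist y x.
Proof. by rewrite /hdist mulrC dotpC. Qed.

Lemma hdistxx x : hdist x x = 0.
Proof.
have := coshK (0 : R); rewrite normr0 => <-; congr acosh.
by rewrite /cosh -expr2 bracket2 oppr0 expR0; field.
Qed.

(* A null vector (k, x) that is Lorentz-orthogonal to the timelike vector
   ([y], y) vanishes. *)
Lemma null_orthogonal_eq0 k x y :
  k * bracket y = dotp x y -> k ^+ 2 = dotp x x -> x = 0.
Proof.
move=> orth null; apply: dotp_eq0; apply/eqP; rewrite eq_le dotp_ge0 andbT.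
have := dotp_CS x y; rewrite -orth exprMn null bracket2; lra.
Qed.

(** Lorentz product 1 makes the difference of the lifts a null vector orthogonal to the lift of
    y. *)
Lemma hdist_eq0 x y : hdist x y = 0 -> x = y.
Proof.
move=> d0; have : lorentz x y = 1.
  by rewrite -cosh_hdist d0 /cosh oppr0 expR0; field.
rewrite /lorentz => e.
have dxy : dotp x y = bracket x * bracket y - 1 by rewrite -e; ring.
apply/eqP; rewrite -subr_eq0; apply/eqP.
rewrite -scaleN1r.
apply: (@null_orthogonal_eq0 (bracket x - bracket y) _ y);
  rewrite !dotpE ?(dotpC y x) ?dxy ?dotpE_bracket; ring.
Qed.

Lemma hdist_between x y z : hdist x z = hdist x y + hdist y z ->
  sinh (hdist x z) *: y = sinh (hdist y z) *: x + sinh (hdist x y) *: z.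
Proof.
set s := hdist x y; set t := hdist y z => e.
have := cosh_hdist x y; have := cosh_hdist y z; have := cosh_hdist x z.
rewrite e coshD sinhD -/s -/t /lorentz => exz eyz exy.
have cs := cosh2 s; have ct := cosh2 t.
move: exz eyz exy cs ct; set cs := cosh s; set ct := cosh t.
set ss := sinh s; set st := sinh t => exz eyz exy cs2 ct2.
apply/eqP; rewrite -subr_eq0; apply/eqP; rewrite -scaleN1r.
have dxy : dotp x y = bracket x * bracket y - cs by rewrite exy; ring.
have dyz : dotp y z = bracket y * bracket z - ct by rewrite eyz; ring.
have dxz : dotp x z = bracket x * bracket z - (cs * ct + ss * st)
  by rewrite exz; ring.
(* The scalar is the time coordinate of the null vector. Orthogonality to Y is the addition formula
   for [sinh]. *)
apply: (@null_orthogonal_eq0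
  ((ss * ct + cs * st) * bracket y - st * bracket x - ss * bracket z) _ y);
  rewrite !dotpE ?(dotpC y x) ?(dotpC z) !dotpE_bracket dxy dyz ?dxz;
  ring: cs2 ct2.
Qed.

(** On lifts, [htrans a] is the Lorentz boost that sends (1, 0) to ([a], a); this is the time
    coordinate of the image. *)
Lemma bracket_htrans a x :
  bracket (htrans a x) = bracket x * bracket a + dotp x a.
Proof.
apply: bracket_eq.
  have := dotp_lt_bracket x a; rewrite ltr_norml => /andP[+ _].
  by rewrite -subr_gt0 opprK addrC => /ltW.
have a0 : bracket a + 1 != 0 by rewrite gt_eqF// addr_gt0 ?bracket_gt0.
by rewrite /htrans !dotpE (dotpC a x) !dotpE_bracket; field.
Qed.

Lemma lorentz_htrans a x y : lorentz (htrans a x) (htrans a y) = lorentz x y.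
Proof.
have a0 : bracket a + 1 != 0 by rewrite gt_eqF// addr_gt0 ?bracket_gt0.
rewrite {1}/lorentz !bracket_htrans /htrans !dotpE (dotpC a y).
by rewrite /lorentz (dotpE_bracket a); field.
Qed.

Lemma bracket_sinh z t : enorm z = 1 -> bracket (sinh t *: z) = cosh t.
Proof.
move=> z1; apply: bracket_eq; first exact/ltW/cosh_gt0.
by rewrite !dotpE -enorm2 z1 cosh2; ring.
Qed.

(** The lift of sinh(t) z is (cosh t, sinh(t) z), so Lorentz products along the curve are cosh(s -
    t), which [acosh] turns into |s - t|. *)
Lemma isometric_htrans_sinh a z : enorm z = 1 ->
  isometric (@hdist R n) (fun t => htrans a (sinh t *: z)).
Proof.
move=> z1 s t _ _; rewrite -coshK; congr acosh.
rewrite -/(lorentz _ _) lorentz_htrans /lorentz !bracket_sinh// !dotpE -enorm2.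
by rewrite z1 coshB; ring.
Qed.

(** The relation has the form of [isometric_sinh] at the parameters 0, t and d(a, b), so that this
    curve can be compared with any isometric map. *)
Lemma htrans_sinh_through a b : a <> b -> exists z, enorm z = 1 /\
  forall t, sinh (hdist a b) *: htrans a (sinh t *: z) =
            sinh (hdist a b - t) *: a + sinh t *: b.
Proof.
move=> ab; set d := hdist a b.
have S0 : sinh d != 0.
  by rewrite sinh_neq0//; apply/eqP => /hdist_eq0.
have := cosh_hdist a b; rewrite -/d /lorentz => cd.
have c2 := cosh2 d.
have dab : dotp a b = bracket a * bracket b - cosh d by rewrite cd; ring.
have a1 : bracket a + 1 != 0 by rewrite gt_eqF// addr_gt0 ?bracket_gt0.
(* The lift of b is cosh(d) A + sinh(d) W with W a unit tangent vector at the lift A of a. Here [w0]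
   is the time coordinate of W, and the boost sends (0, z) to W. *)
pose w0 := (bracket b - cosh d * bracket a) / sinh d.
pose z := (sinh d)^-1 *: (b + (- cosh d) *: a) +
  (- (w0 / (bracket a + 1))) *: a.
have za : dotp z a = w0.
  rewrite /z !dotpE (dotpC b) dab dotpE_bracket /w0; field.
  by rewrite S0 a1.
have z1 : enorm z = 1.
  rewrite /enorm.
  suff -> : dotp z z = 1 by rewrite sqrtr1.
  rewrite /z !dotpE (dotpC b a) dab !dotpE_bracket /w0; field: c2.
  by rewrite S0 a1.
exists z; split=> // t.
rewrite /htrans bracket_sinh// dotpZl za sinhB.
by apply/rowP => i; rewrite !mxE; field; rewrite S0 a1.
Qed.

End HyperbolicSpace.

(** * Metric collinearity as three equations between distances *)

Section MetricCollinearity.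
Context {R : realType} {X : Type} {d : X -> X -> R}.
Hypotheses (dxx : forall x, d x x = 0) (dC : forall x y, d x y = d y x).
Implicit Types a b c : X.

Lemma metrically_collinearP a b c : metrically_collinear d a b c <->
  [\/ d a b = d a c + d c b, d a c = d a b + d b c | d b c = d b a + d a c].
Proof.
split; last first.
  case=> e; [exists a, c, b | exists a, b, c | exists b, a, c]; split=> //;
    by apply/seteqP; split=> u /=; tauto.
move=> [x [y [z [e h]]]].
have [hx hy hz] : [/\ [set a; b; c] x, [set a; b; c] y & [set a; b; c] z].
  by rewrite -e /=; split; tauto.
have [ha hb hc] : [/\ [set x; y; z] a, [set x; y; z] b & [set x; y; z] c].
  by rewrite e /=; split; tauto.
move: hx hy hz ha hb hc => {e} /= hx hy hz ha hb hc.
have := (dC a b, dC a c, dC b c) => -[[sab sac] sbc].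
(* Without coincidences x, y, z is a permutation of a, b, c. A coincidence makes one of the
   equations trivial, since [d x x] is 0. *)
have K : a = b \/ b = c \/ a = c \/
    [\/ d a b = d a c + d c b, d a c = d a b + d b c | d b c = d b a + d a c].
  have [D|] := pselect (a = b); first by left.
  have [D|] := pselect (b = c); first by right; left.
  have [D|] := pselect (a = c); first by right; right; left.
  move=> ac bc ab; right; right; right.
  case: hx => [[]|] ?; subst x; case: hy => [[]|] ?; subst y;
  case: hz => [[]|] ?; subst z; try by exfalso; intuition congruence.
  - by apply: Or32.
  - by apply: Or31.
  - by apply: Or33.
  - by apply: Or31; lra.
  - by apply: Or33; lra.
  - by apply: Or32; lra.
by case: K => [->|[->|[->|//]]];
  [apply: Or32 | apply: Or31 | apply: Or31]; rewrite dxx ?add0r ?addr0.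
Qed.

Lemma metrically_collinearC a b c :
  metrically_collinear d a b c -> metrically_collinear d a c b.
Proof.
move/metrically_collinearP => h; apply/metrically_collinearP.
case: h => e; [exact: Or32|exact: Or31|].
by apply: Or33; rewrite (dC c) e (dC b) (dC c) addrC.
Qed.

End MetricCollinearity.

(** * Isometric maps from intervals and from the real line *)

Section HyperbolicLines.
Context {R : realType} {n : nat}.
Implicit Types (x y z a b : 'rV[R]_n) (g : R -> 'rV[R]_n) (p q r s t : R).
Local Notation d := (@hdist R n).

Lemma isometric_sinh g : isometric d g -> forall r s t,
  sinh (t - r) *: g s = sinh (t - s) *: g r + sinh (s - r) *: g t.
Proof.
move=> gi.
have sorted r s t : r <= s -> s <= t ->
    sinh (t - r) *: g s = sinh (t - s) *: g r + sinh (s - r) *: g t.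
  move=> rs st; have := @hdist_between _ _ (g r) (g s) (g t).
  rewrite !gi// !ler0_norm; [|lra..].
  by rewrite !opprB; apply; ring.
(* The difference of the two sides is alternating in r, s, t because [sinh] is odd, so every order
   reduces to the sorted one. *)
move=> r s t; apply/rowP => i.
have [rs|sr] := leP r s; have [st|ts] := leP s t; have [rt|tr] := leP r t;
  try lra.
- by rewrite sorted.
- have /rowP/(_ i) := sorted _ _ _ rt (ltW ts).
  by rewrite !mxE !sinhB; lra.
- have /rowP/(_ i) := sorted _ _ _ (ltW tr) rs.
  by rewrite !mxE !sinhB; lra.
- have /rowP/(_ i) := sorted _ _ _ (ltW sr) rt.
  by rewrite !mxE !sinhB; lra.
- have /rowP/(_ i) := sorted _ _ _ st (ltW tr).
  by rewrite !mxE !sinhB; lra.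
- have /rowP/(_ i) := sorted _ _ _ (ltW ts) (ltW sr).
  by rewrite !mxE !sinhB; lra.
Qed.

Lemma metric_segmentC a b : metric_segment d a b = metric_segment d b a.
Proof.
by apply/seteqP; split=> x; rewrite /metric_segment /=
  (hdistC a b) (hdistC a x) (hdistC x b) addrC.
Qed.

Lemma isometric_on_segment g p q : p < q -> isometric_on d `[p, q] g ->
  g @` `[p, q] = metric_segment d (g p) (g q).
Proof.
move=> pq gi.
have dist s t : p <= s -> s <= t -> t <= q -> d (g s) (g t) = t - s.
  move=> ps st tq; rewrite gi; first by rewrite ler0_norm ?opprB//; lra.
    by rewrite /= in_itv /=; lra.
  by rewrite /= in_itv /=; lra.
apply/seteqP; split=> [_ [u + <-]|x].
  rewrite /metric_segment /= in_itv /= => /andP[pu uq].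
  rewrite !dist//; [ring|lra].
rewrite /metric_segment /= => e; have := e; rewrite dist//; last lra.
have := hdist_ge0 (g p) x; have := hdist_ge0 x (g q).
set s := d (g p) x; set t := d x (g q) => t0 s0 est.
(* The points x and [g (p + s)] have the same distances s and t to the endpoints, so [hdist_between]
   gives both the same value after scaling by sinh(q - p). *)
exists (p + s); first by rewrite /= in_itv /=; lra.
have S0 : sinh (q - p) != 0 by rewrite sinh_neq0// gt_eqF// subr_gt0.
apply: (scalerI S0).
have := hdist_between _ _ _ e; rewrite -/s -/t dist//; last lra.
move=> ->.
have := @hdist_between _ _ (g p) (g (p + s)) (g q).
rewrite !dist; [|lra..].
have -> : q - (p + s) = t by lra.
have -> : p + s - p = s by lra.
by apply; lra.
Qed.

Lemma isometric_range_collinear g p q : p < q -> isometric d g ->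
  range g = metric_line d (g p) (g q).
Proof.
move=> pq gi.
have S0 s : 0 < s -> sinh s != 0 by move=> ?; rewrite sinh_neq0// gt_eqF.
apply/seteqP; split=> [_ [u _ <-]|x] /=.
  rewrite /metric_line /=; apply/(metrically_collinearP hdistxx hdistC).
  rewrite !gi//.
  have [pu|up] := leP p u; have [qu|uq] := leP q u.
  - by apply: Or31; rewrite !ger0_norm ?ler0_norm; lra.
  - apply: Or33; rewrite (ler0_norm (_ : p - q <= 0)); last lra.
    by rewrite !ler0_norm; lra.
  - by lra.
  - by apply: Or32; rewrite !ler0_norm; lra.
have dpq : d (g p) (g q) = q - p by rewrite gi// ler0_norm; lra.
case/(metrically_collinearP hdistxx hdistC) => e.
- have := hdist_ge0 x (g q); set s := d x (g q) in e *.
  rewrite le_eqVlt => /orP[/eqP/esym/hdist_eq0->|s0]; first by exists q.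
  (* Here x lies beyond [g q], at distance s. Betweenness of [g q] and the relation for g at p, q, q
     + s differ only in having x or [g (q + s)] with coefficient sinh(q - p). *)
  exists (q + s) => //; apply: (scalerI (S0 (q - p) _)); first lra.
  have := hdist_between _ _ _ e; rewrite e -/s (hdistC _ (g p)) dpq => /rowP h.
  have := isometric_sinh g gi p q (q + s) => /rowP h'.
  apply/rowP => i; have := h i; have := h' i; rewrite !mxE.
  have -> : q + s - p = s + (q - p) by ring.
  have -> : q + s - q = s by ring.
  by lra.
- have := hdist_ge0 x (g p); set s := d x (g p) in e *.
  rewrite le_eqVlt => /orP[/eqP/esym/hdist_eq0->|s0]; first by exists p.
  (* The mirror case: x lies before [g p], at distance s. *)
  exists (p - s) => //; apply: (scalerI (S0 (q - p) _)); first lra.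
  have := hdist_between _ _ _ e; rewrite e -/s dpq => /rowP h.
  have := isometric_sinh g gi (p - s) p q => /rowP h'.
  apply/rowP => i; have := h i; have := h' i; rewrite !mxE.
  have -> : q - (p - s) = s + (q - p) by ring.
  have -> : p - (p - s) = s by ring.
  by lra.
- suff : (g @` `[p, q]) x by case=> u _ <-; exists u.
  by rewrite isometric_on_segment// => s t _ _; apply: gi.
Qed.

(** Both g and the explicit curve from [g 0] through [g 1] satisfy the same relation at 0, t, 1, and
    sinh 1 cancels. *)
Lemma isometric_htransE g : isometric d g ->
  exists z, enorm z = 1 /\ forall t, g t = htrans (g 0) (sinh t *: z).
Proof.
move=> gi; have d01 : d (g 0) (g 1) = 1 by rewrite gi// sub0r normrN normr1.
have [e|z [z1 hz]] := htrans_sinh_through (g 0) (g 1).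
  by have := hdistxx (g 0); rewrite {2}e d01; lra.
exists z; split=> // t.
have S0 : sinh (1 : R) != 0 by rewrite sinh_neq0 ?oner_eq0.
apply: (scalerI S0); have := hz t; rewrite d01 => ->.
by have := isometric_sinh g gi 0 t 1; rewrite !subr0.
Qed.

Lemma hyperbolic_geodesic a b : a <> b -> exists g,
  [/\ 0 < d a b, isometric d g, g 0 = a & g (d a b) = b].
Proof.
move=> ab; have d0 : 0 < d a b.
  rewrite lt_neqAle hdist_ge0 andbT eq_sym; apply/eqP => /hdist_eq0; exact: ab.
have [z [z1 hz]] := htrans_sinh_through a b ab.
have S0 : sinh (d a b) != 0 by rewrite sinh_neq0// gt_eqF.
exists (fun t => htrans a (sinh t *: z)); split=> //.
- exact: isometric_htrans_sinh.
(* At t = 0 and at t = d(a, b) one of the two terms of the relation vanishes. *)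
- by apply: (scalerI S0); rewrite hz sinh0 subr0 scale0r addr0.
- by apply: (scalerI S0); rewrite hz subrr sinh0 scale0r add0r.
Qed.

End HyperbolicLines.

Theorem theorem4p1 (R : realType) (n : nat) (hn : (0 < n)%N)
    (a b : 'rV[R]_n) (hab : a <> b) :
  [/\ (* (A) *)
      segment_joining (@hdist R n) (metric_segment (@hdist R n) a b) a b /\
      (forall S : set 'rV[R]_n, segment_joining (@hdist R n) S a b ->
         S = metric_segment (@hdist R n) a b),
      (* (B) *)
      [/\ hyperbolic_line (metric_line (@hdist R n) a b),
          metric_line (@hdist R n) a b a,
          metric_line (@hdist R n) a b b &
          forall L : set 'rV[R]_n, hyperbolic_line L -> L a -> L b ->
            L = metric_line (@hdist R n) a b] &
      (* (C) *)
      forall g : R -> 'rV[R]_n, isometric (@hdist R n) g -> g 0 = a ->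
        exists z : 'rV[R]_n,
          enorm z = 1 /\ forall t : R, g t = htrans a (sinh t *: z)].
Proof.
(* This one geodesic gives existence in both (A) and (B). *)
have [g [d0 gi g0 gd]] := hyperbolic_geodesic a b hab.
set d := @hdist R n in d0 gi gd *.
have gE : range g = metric_line d a b.
  by rewrite (isometric_range_collinear _ _ _ d0 gi) g0 gd.
split; [split|split|].
- have gi' : isometric_on d `[0, d a b] g by move=> s t _ _; apply: gi.
  exists 0, (d a b), g; split=> //; first exact: ltW.
    by rewrite (isometric_on_segment _ _ _ d0 gi') g0 gd.
  by rewrite g0 gd.
- move=> S [p [q [h [pq hi -> e]]]].
  have ha : [set h p; h q] a by rewrite e; left.
  have hb : [set h p; h q] b by rewrite e; right.
  have {}pq : p < q.
    rewrite lt_neqAle pq andbT; apply/eqP => pq'; apply: hab.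
    by move: ha hb; rewrite pq' /= => -[->|->] -[->|->].
  rewrite (isometric_on_segment _ _ _ pq hi).
  (* The segment may run from a to b or from b to a. *)
  move: ha hb => /= -[ha|ha] -[hb|hb]; try by case: hab; rewrite ha hb.
    by rewrite ha hb.
  by rewrite ha hb metric_segmentC.
- by exists g.
- by rewrite -gE; exists 0.
- by rewrite -gE; exists (d a b).
- move=> _ [h [hi ->]] [p _ ha] [q _ hb]; rewrite -ha -hb.
  (* The line may meet b before a; collinearity is symmetric in its last two points. *)
  have [pq|qp|pq] := ltgtP p q.
  + exact: isometric_range_collinear.
  + rewrite (isometric_range_collinear _ _ _ qp hi).
    by apply/seteqP; split=> x;
      apply: (metrically_collinearC (@hdistxx R n) (@hdistC R n)).
  + by case: hab; rewrite -ha -hb pq.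
- by move=> h hi <-; apply: isometric_htransE.
Qed.
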